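(* Let $F\in\mathbb{R}[x,y,z]$, let $\mathcal{S}=\{F=0\}\subset\mathbb{R}^3$, and let $P=(a,b,c)$ be a regular point of $\mathcal{S}$, i.e. $F(P)=0$ and $\nabla F(P)\neq 0$. Let $$\mathbf{r}(s,t)=P+s\,\mathbf{u}_1+t\,\mathbf{u}_2+\tfrac12\bigl(s^2\mathbf{u}_3+2st\,\mathbf{u}_4+t^2\mathbf{u}_5\bigr),\qquad \mathbf{u}_i=(a_i,b_i,c_i)\in\mathbb{R}^3,\quad \mathbf{u}_1\times\mathbf{u}_2\neq0,$$ be any quadratic parametric surface such that the coefficients $C_{1,0},C_{0,1},C_{2,0},C_{1,1},C_{0,2}$ of $s,t,s^2,st,t^2$ in $F(\mathbf{r}(s,t))$ all vanish (the conditions of the quadratic-contact algorithm described in the context), oriented so that its unit normal $\mathbf{n}=\dfrac{\mathbf{r}_s\times\mathbf{r}_t}{|\mathbf{r}_s\times\mathbf{r}_t|}$ at $(s,t)=(0,0)$ equals $\nabla F/|\nabla F|$. Then the Gauss and mean curvatures of $\mathcal{S}$ at $P$ computed by the algorithm, i.e. those of $\mathbf{r}$ at $(0,0)$, are $$K_G=\frac{LN-M^2}{\mathcal{E}\mathcal{G}-\mathcal{F}^2}=\frac{\nabla F\, H^*(F)\,\nabla F^T}{|\nabla F|^4},$$ $$K_M=\frac{\mathcal{E}N-2\mathcal{F}M+\mathcal{G}L}{2(\mathcal{E}\mathcal{G}-\mathcal{F}^2)}=\frac{\nabla F\, H(F)\,\nabla F^T-|\nabla F|^2\,\mathrm{Trace}(H(F))}{2|\nabla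 F|^3},$$ where all derivatives of $F$ are evaluated at $P$.
   Context: $\nabla F$ is regarded as a row vector, $H(F)$ is the $3\times3$ Hessian matrix of $F$, and $H^*(F)$ is its adjoint (adjugate, i.e. classical adjoint) matrix. The first and second fundamental form coefficients of $\mathbf{r}$ at $(0,0)$ are $\mathcal{E}=\mathbf{r}_s\cdot\mathbf{r}_s$, $\mathcal{F}=\mathbf{r}_s\cdot\mathbf{r}_t$, $\mathcal{G}=\mathbf{r}_t\cdot\mathbf{r}_t$, $L=\mathbf{r}_{ss}\cdot\mathbf{n}$, $M=\mathbf{r}_{st}\cdot\mathbf{n}$, $N=\mathbf{r}_{tt}\cdot\mathbf{n}$. Algorithm (surfaces). Let $P$ be a point of $\mathcal{S}=\{F=0\}$ of multiplicity $r$ ($r$ is the least order for which some partial derivative of $F$ is nonzero at $P$; $r=1$ exactly when $P$ is regular). Take a quadratic parametric surface $\mathbf{r}(s,t)$ through $P$ as in the claim, with $\mathbf{r}_s\times\mathbf{r}_t\neq0$ at $(0,0)$, expand $F(\mathbf{r}(s,t))=\sum C_{i,j}s^it^j$, and put $C_m=(C_{m,0},C_{m-1,1},\ldots,C_{0,m})$. The normals $\mathbf{r}_s\times\mathbf{r}_t$ of the tangent planes to $\mathcal{S}$ at $P$ are determined by $C_r=0$. With these first-order coefficients substituted, the next vector $C_l$ that is not identically zero is set to zero, which constrains the second-order coefficients. The curvatures of $\mathcal{S}$ at $P$ along that normal are defined to be those of $\mathbf{r}$ at $(0,0)$. For a regular point ($r=1$) the conditions imposed are exactly $C_1=0$ and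 $C_2=0$. *)

(* Defs.v *)
From mathcomp Require Import all_boot all_order all_algebra.
From mathcomp Require Import reals mpoly.

Set Implicit Arguments.
Unset Strict Implicit.
Unset Printing Implicit Defensive.

Import Order.TTheory GRing.Theory Num.Theory.
Local Open Scope ring_scope.

(* Vectors of R^3 are row vectors; x, y, z are the variables 'X_0, 'X_1, 'X_2
   of {mpoly R[3]}, and s, t are the variables 'X_0, 'X_1 of {mpoly R[2]}.
   All functions involved are polynomials, so the partial derivatives are the
   formal ones, followed by evaluation. *)

Section Vectors.
Context {R : realType}.
Implicit Types u v : 'rV[R]_3.

Definition dotmul u v : R := \sum_i u 0 i * v 0 i.

(* Euclidean norm; `|u| on row vectors is the sup norm. *)
Definition vnorm u : R := Num.sqrt (dotmul u u).

(* Indices are taken in Z/3Z: (u x v)_i = u_(i+1) v_(i+2) - u_(i+2) v_(i+1). *)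
Definition crossmul u v : 'rV[R]_3 :=
  \row_(i < 3) (u 0 (i + 1) * v 0 (i + 2%:R) - u 0 (i + 2%:R) * v 0 (i + 1)).

End Vectors.

Section ImplicitSurface.
Context {R : realType}.
Implicit Types (F : {mpoly R[3]}) (P : 'rV[R]_3).

Definition eval_at F P : R := F.@[fun i => P 0 i].

Definition grad F P : 'rV[R]_3 := \row_i eval_at (F^`M(i)) P.

Definition hessian F P : 'M[R]_3 :=
  \matrix_(i, j) eval_at ((F^`M(i))^`M(j)) P.

Definition regular_point F P : Prop := eval_at F P = 0 /\ grad F P != 0.

End ImplicitSurface.

Section ParametricSurface.
Context {R : realType}.

(* Polynomial maps R^2 -> R^3, given by their three coordinates. *)
Definition psurface := 3.-tuple {mpoly R[2]}.
Implicit Type r : psurface.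

Definition quad_surface (P u1 u2 u3 u4 u5 : 'rV[R]_3) : psurface :=
  [tuple (P 0 i)%:MP + u1 0 i *: 'X_0 + u2 0 i *: 'X_1
         + 2%:R^-1 *: (u3 0 i *: 'X_0 ^+ 2 + (2%:R * u4 0 i) *: ('X_0 * 'X_1)
                       + u5 0 i *: 'X_1 ^+ 2) | i < 3].

(* The coefficient C_(i,j) of s^i t^j in F(r(s,t)). *)
Definition contact_coef (F : {mpoly R[3]}) r (i j : nat) : R :=
  (F \mPo r)@_[multinom [tuple i; j]].

Definition at_origin r : 'rV[R]_3 := \row_i (tnth r i).@[fun=> 0].

Definition pderiv (k : 'I_2) r : psurface := [tuple (tnth r i)^`M(k) | i < 3].

Definition r_s r := at_origin (pderiv 0 r).
Definition r_t r := at_origin (pderiv 1 r).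
Definition r_ss r := at_origin (pderiv 0 (pderiv 0 r)).
Definition r_st r := at_origin (pderiv 1 (pderiv 0 r)).
Definition r_tt r := at_origin (pderiv 1 (pderiv 1 r)).

Definition unit_normal r : 'rV[R]_3 :=
  (vnorm (crossmul (r_s r) (r_t r)))^-1 *: crossmul (r_s r) (r_t r).

Definition ffE r : R := dotmul (r_s r) (r_s r).
Definition ffF r : R := dotmul (r_s r) (r_t r).
Definition ffG r : R := dotmul (r_t r) (r_t r).
Definition sfL r : R := dotmul (r_ss r) (unit_normal r).
Definition sfM r : R := dotmul (r_st r) (unit_normal r).
Definition sfN r : R := dotmul (r_tt r) (unit_normal r).

(* Gauss and mean curvatures of r at (s,t) = (0,0). *)
Definition gauss_curvature r : R :=
  (sfL r * sfN r - sfM r ^+ 2) / (ffE r * ffG r - ffF r ^+ 2).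

Definition mean_curvature r : R :=
  (ffE r * sfN r - 2%:R * ffF r * sfM r + ffG r * sfL r)
    / (2%:R * (ffE r * ffG r - ffF r ^+ 2)).

End ParametricSurface.

Arguments psurface : clear implicits.

(* Main.v *)
Require Import Defs.
From mathcomp Require Import all_boot all_order all_algebra.
From mathcomp Require Import reals mpoly ring.

(* By the chain rule, C_(2,0) = C_(1,1) = C_(0,2) = 0 say that
   r_kl . nabla F = - r_k H r_l^T for k, l in {s, t}, so the second fundamental
   form of r is that of - H / |nabla F| restricted to the tangent plane.  Since
   r_s x r_t is parallel to nabla F, the two formulas then follow from
   the identities, for symmetric H and w = u x v,
     (u H u^T) (v H v^T) - (u H v^T)^2 = w adj(H) w^T,
     |u|^2 (v H v^T) - 2 (u . v) (u H v^T) + |v|^2 (u H u^T)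
       = |w|^2 tr H - w H w^T. *)

Import Order.TTheory GRing.Theory Num.Theory.
Local Open Scope ring_scope.

(** * Chain rule for composed polynomials *)

Section ChainRule.
Variables (R : comNzRingType) (n k : nat) (q : n.-tuple {mpoly R[k]}).

(** The set of [p] satisfying the rule is closed under sums, and under products by the Leibniz rule,
    so constants and variables suffice. *)
Lemma mderiv_comp_mpoly (l : 'I_k) (p : {mpoly R[n]}) :
  (p \mPo q)^`M(l) = \sum_i (p^`M(i) \mPo q) * (tnth q i)^`M(l).
Proof.
pose chain p := (p \mPo q)^`M(l) = \sum_i (p^`M(i) \mPo q) * (tnth q i)^`M(l).
have chainC c : chain c%:MP.
  rewrite /chain comp_mpolyC mderivC big1 // => i _.
  by rewrite mderivC comp_mpoly0 mul0r.
have chainM p1 p2 : chain p1 -> chain p2 -> chain (p1 * p2).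
  rewrite /chain rmorphM mderivM => -> ->; rewrite mulr_suml mulr_sumr.
  rewrite -big_split; apply: eq_bigr => i _ /=.
  by rewrite mderivM rmorphD !rmorphM /=; ring.
(* [mderivX] subtracts exponents; this makes the derivative of ['X_i] the monomial with exponent 0,
   that is 1. *)
have UU i : (U_(i) - U_(i) = 0 :> 'X_{1..n})%MM.
  by apply/mnmP=> j; rewrite mnmBE subnn mnm0E.
have chainX i : chain 'X_i.
  rewrite /chain comp_mpolyXU -tnth_nth (bigD1 i) //= big1 => [|j ji].
    by rewrite addr0 mderivX mnm1E eqxx scale1r UU mpolyX0 rmorph1 mul1r.
  by rewrite mderivX mnm1E eq_sym (negPf ji) scale0r rmorph0 mul0r.
rewrite -/(chain p); elim/mpolyind: p => [|c m p _ _ IHp].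
  by rewrite -(mpolyC0 n).
rewrite /chain rmorphD mderivD {}IHp.
(* A term is a constant times a product of powers of variables, hence reached through [chainC],
   [chainX] and [chainM]. *)
have -> : chain (c *: 'X_[m]).
  rewrite -mul_mpolyC mpolyXE_id; apply: (chainM) => //.
  apply: (big_ind chain) => // [|i _]; first by rewrite -mpolyC1.
  by elim: (m i) => [|d IHd]; rewrite ?expr0 -?mpolyC1 ?exprS //; apply: chainM.
rewrite -big_split; apply: eq_bigr => i _ /=.
by rewrite mderivD rmorphD mulrDl.
Qed.

Lemma meval_mderiv_comp_mpoly (l : 'I_k) (p : {mpoly R[n]}) v :
  ((p \mPo q)^`M(l)).@[v] =
    \sum_i p^`M(i).@[fun i => (tnth q i).@[v]] * (tnth q i)^`M(l).@[v].
Proof.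
rewrite mderiv_comp_mpoly rmorph_sum; apply: eq_bigr => i _ /=.
by rewrite mevalM comp_mpoly_meval.
Qed.

Lemma meval_mderiv2_comp_mpoly (l h : 'I_k) (p : {mpoly R[n]}) v
    (w := fun i => (tnth q i).@[v]) :
  ((p \mPo q)^`M(l)^`M(h)).@[v] =
    \sum_i ((\sum_j p^`M(i)^`M(j).@[w] * (tnth q j)^`M(h).@[v])
              * (tnth q i)^`M(l).@[v]
            + p^`M(i).@[w] * (tnth q i)^`M(l)^`M(h).@[v]).
Proof.
rewrite mderiv_comp_mpoly (raddf_sum (mderiv h)) rmorph_sum.
apply: eq_bigr => i _ /=.
by rewrite mderivM mevalD !mevalM meval_mderiv_comp_mpoly comp_mpoly_meval.
Qed.

End ChainRule.

(** Every nonconstant monomial has a positive exponent and so vanishes at 0. Applied to derivatives,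
    this turns their values at the origin into Taylor coefficients. *)
Lemma meval0_mcoeff (R : comNzRingType) n (p : {mpoly R[n]}) :
  p.@[fun=> 0] = p@_0%MM.
Proof.
elim/mpolyind: p => [|c m p _ _ IHp]; first by rewrite meval0 mcoeff0.
rewrite mevalD mcoeffD IHp mevalZ mcoeffZ mevalX mcoeffX; congr (_ * _ + _).
have [->|] := eqVneq m 0%MM.
  by rewrite big1 // => i _; rewrite mnm0E expr0.
rewrite -mdeg_eq0 mdegE sum_nat_eq0 negb_forall => /existsP[i].
rewrite implyTb => mi.
by rewrite (bigD1 i) //= expr0n (negPf mi) mul0r.
Qed.

(** * Quadratic forms and cross products in R^3 *)

Section Vectors.
Context {R : realType}.
Implicit Types (u v w : 'rV[R]_3) (A : 'M[R]_3).

Lemma sum_ord3 (f : 'I_3 -> R) : \sum_i f i = f 0 + f 1 + f 2%:R.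
Proof.
rewrite !big_ord_recl big_ord0 addr0 addrA.
by congr (f _ + f _ + f _); apply: val_inj.
Qed.

Definition bilin A u v : R := (u *m A *m v^T) 0 0.

Lemma bilinE A u v : bilin A u v = \sum_j (\sum_i u 0 i * A i j) * v 0 j.
Proof. by rewrite /bilin mxE; apply: eq_bigr => j _; rewrite !mxE. Qed.

Lemma ord3_add :
  (((0 + 1)%R = 1 :> 'I_3) * ((0 + 2%:R)%R = 2%:R :> 'I_3) *
   ((1 + 1)%R = 2%:R :> 'I_3) * ((1 + 2%:R)%R = 0 :> 'I_3) *
   ((2%:R + 1)%R = 0 :> 'I_3) * ((2%:R + 2%:R)%R = 1 :> 'I_3))%type.
Proof. by do ! split; apply: val_inj. Qed.

Lemma ord3P (i : 'I_3) : [\/ i = 0, i = 1 | i = 2%:R].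
Proof.
by case: i => [[|[|[|//]]]] lt_i3; [apply: Or31|apply: Or32|apply: Or33];
  apply: val_inj.
Qed.

(** With indices in Z/3Z, the cyclic order of rows and columns absorbs the cofactor sign
    (-1)^(i+j). *)
Lemma adj_mx3 A i j : \adj A i j =
  A (j + 1) (i + 1) * A (j + 2%:R) (i + 2%:R)
  - A (j + 1) (i + 2%:R) * A (j + 2%:R) (i + 1).
Proof.
(* Indexing entries by naturals lets [ring] identify entries whose ordinal indices are equal but
   written differently. *)
have [a AE] : exists a, forall k l : 'I_3, A k l = a (val k) (val l).
  by exists (fun k l => A (inord k) (inord l)) => k l; rewrite !inord_val.
rewrite mxE /cofactor (expand_det_row _ ord0) !big_ord_recl big_ord0.
rewrite /cofactor !det_mx11 !mxE.
by case: (ord3P i) => ->; case: (ord3P j) => ->; rewrite !ord3_add !AE /=; ring.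
Qed.

(** Conceptually, Au x Av = adj(A)^T (u x v), and Binet-Cauchy expands (Au x Av) . (u x v) into the
    left side; symmetry of [A] merges the two mixed terms. *)
Lemma gauss_identity A u v : A^T = A ->
  bilin A u u * bilin A v v - bilin A u v ^+ 2 =
    bilin (\adj A) (crossmul u v) (crossmul u v).
Proof.
move=> As; have AC i j : A i j = A j i by rewrite -{1}As mxE.
rewrite !bilinE !sum_ord3 !adj_mx3 /crossmul !mxE !ord3_add.
rewrite (AC 1 0) (AC 2%:R 0) (AC 2%:R 1).
move: (A 0 0) (A 0 1) (A 0 2%:R) (A 1 1) (A 1 2%:R) (A 2%:R 2%:R).
move: (u 0 0) (u 0 1) (u 0 2%:R) (v 0 0) (v 0 1) (v 0 2%:R).
by move=> *; ring.
Qed.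

(** This is the coefficient of e in [gauss_identity] for 1 + e A, since adj(1 + e A) = 1 + e (tr A -
    A) + O(e^2); the constant term is [lagrange_identity]. *)
Lemma mean_identity A u v : A^T = A ->
  dotmul u u * bilin A v v - 2%:R * dotmul u v * bilin A u v
    + dotmul v v * bilin A u u =
  dotmul (crossmul u v) (crossmul u v) * \tr A
    - bilin A (crossmul u v) (crossmul u v).
Proof.
move=> As; have AC i j : A i j = A j i by rewrite -{1}As mxE.
rewrite /dotmul /mxtrace !bilinE !sum_ord3 /crossmul !mxE !ord3_add.
rewrite (AC 1 0) (AC 2%:R 0) (AC 2%:R 1).
move: (A 0 0) (A 0 1) (A 0 2%:R) (A 1 1) (A 1 2%:R) (A 2%:R 2%:R).
move: (u 0 0) (u 0 1) (u 0 2%:R) (v 0 0) (v 0 1) (v 0 2%:R).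
by move=> *; ring.
Qed.

Lemma lagrange_identity u v :
  dotmul u u * dotmul v v - dotmul u v ^+ 2 =
    dotmul (crossmul u v) (crossmul u v).
Proof.
rewrite /dotmul !sum_ord3 /crossmul !mxE !ord3_add.
move: (u 0 0) (u 0 1) (u 0 2%:R) (v 0 0) (v 0 1) (v 0 2%:R).
by move=> *; ring.
Qed.

Lemma bilinZ A k u v : bilin A (k *: u) (k *: v) = k ^+ 2 * bilin A u v.
Proof.
by rewrite /bilin linearZ /= -!scalemxAl -scalemxAr !mxE expr2 mulrA.
Qed.

Lemma dotmulZr k u v : dotmul u (k *: v) = k * dotmul u v.
Proof.
by rewrite /dotmul mulr_sumr; apply: eq_bigr => i _; rewrite mxE mulrCA.
Qed.

Lemma dotmulC u v : dotmul u v = dotmul v u.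
Proof. by apply: eq_bigr => i _; rewrite mulrC. Qed.

Lemma dotmul_ge0 u : 0 <= dotmul u u.
Proof. by apply: sumr_ge0 => i _; rewrite -expr2 sqr_ge0. Qed.

Lemma vnorm_gt0 u : (0 < vnorm u) = (u != 0).
Proof.
rewrite sqrtr_gt0 lt_def dotmul_ge0 andbT; congr (~~ _).
apply/eqP/eqP => [/psumr_eq0P u0 | ->].
  apply/rowP => i; rewrite mxE; apply/eqP; rewrite -sqrf_eq0 expr2 u0 //.
  by move=> j _; rewrite -expr2 sqr_ge0.
by apply: big1 => i _; rewrite mxE mulr0.
Qed.

Lemma sqr_vnorm u : vnorm u ^+ 2 = dotmul u u.
Proof. by rewrite sqr_sqrtr ?dotmul_ge0. Qed.

End Vectors.

(** * Second derivatives of F(r(s,t)) at the origin *)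

Section Contact.
Context {R : realType}.
Variables (F : {mpoly R[3]}) (P : 'rV[R]_3) (r : psurface R).
Hypothesis rP : at_origin r = P.

Lemma hessian_sym : (hessian F P)^T = hessian F P.
Proof. by apply/matrixP => i j; rewrite !mxE mderiv_comm. Qed.

Lemma second_deriv_contact k l :
  ((F \mPo r)^`M(k)^`M(l)).@[fun=> 0] =
    bilin (hessian F P) (at_origin (pderiv k r)) (at_origin (pderiv l r))
    + dotmul (grad F P) (at_origin (pderiv l (pderiv k r))).
Proof.
have rE i : (tnth r i).@[fun=> 0] = P 0 i by rewrite -rP mxE.
rewrite meval_mderiv2_comp_mpoly big_split /=; congr (_ + _); last first.
  apply: eq_bigr => i _; rewrite !mxE !tnth_mktuple; congr (_ * _).
  exact: meval_eq.
rewrite bilinE; under [RHS]eq_bigr do rewrite mulr_suml.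
rewrite [RHS]exchange_big; apply: eq_bigr => i _; rewrite mulr_suml.
apply: eq_bigr => j _; rewrite !mxE !tnth_mktuple mulrC mulrA.
by congr (_ * _ * _); apply: meval_eq.
Qed.

(** The two exponents count the occurrences of s and of t among [k] and [l], so one statement covers
    the three second-order coefficients. *)
Lemma second_order_contact (k l : 'I_2) :
  contact_coef F r ((k == 0)%R + (l == 0)%R) ((k == 1)%R + (l == 1)%R) = 0 ->
  dotmul (at_origin (pderiv l (pderiv k r))) (grad F P) =
    - bilin (hessian F P) (at_origin (pderiv k r)) (at_origin (pderiv l r)).
Proof.
rewrite /contact_coef => C0; apply/eqP; rewrite dotmulC -addr_eq0 addrC.
(* The second derivative at the origin is an integer multiple of the coefficient at exponent [m], so
   it vanishes with it. *)
rewrite -second_deriv_contact meval0_mcoeff !mcoeff_deriv.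
set m := (_ + _)%MM.
suff -> :
  m = [multinom [tuple (k == 0)%R + (l == 0)%R; (k == 1)%R + (l == 1)%R]%N].
  by rewrite C0 !mul0rn.
apply/mnmP => -[[|[|//]]] lt_i2; rewrite !mnmDE mnm0E !mnm1E addnC;
  by rewrite mnm_tnth.
Qed.

End Contact.

(** * The two curvature formulas *)

Lemma curvatures_of_contact (R : realType) (F : {mpoly R[3]}) (P : 'rV[R]_3)
    (r : psurface R) (nF := grad F P) (H := hessian F P) :
  at_origin r = P ->
  nF != 0 ->
  contact_coef F r 2 0 = 0 ->
  contact_coef F r 1 1 = 0 ->
  contact_coef F r 0 2 = 0 ->
  unit_normal r = (vnorm nF)^-1 *: nF ->
  gauss_curvature r = bilin (\adj H) nF nF / vnorm nF ^+ 4 /\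
  mean_curvature r =
    (bilin H nF nF - vnorm nF ^+ 2 * \tr H) / (2%:R * vnorm nF ^+ 3).
Proof.
move=> rP nF0 C20 C11 C02 nE.
have Hs : H^T = H := hessian_sym F P.
have a0 : vnorm nF != 0 by rewrite gt_eqF ?vnorm_gt0.
set w := crossmul (r_s r) (r_t r).
have w0 : w != 0.
  (* If [w] were 0, [unit_normal r] would be 0 too, but it equals the normalised gradient. *)
  apply: contra_neq nF0 => w0; apply/eqP; move/eqP: nE.
  rewrite /unit_normal -/w w0 scaler0 eq_sym scaler_eq0 invr_eq0.
  by rewrite (negPf a0).
have b0 : vnorm w != 0 by rewrite gt_eqF ?vnorm_gt0.
have nFE : nF = (vnorm nF / vnorm w) *: w.
  by rewrite -scalerA -[_ *: w]/(unit_normal r) nE scalerA divff ?scale1r.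
have LE : sfL r = - bilin H (r_s r) (r_s r) / vnorm nF.
  by rewrite /sfL nE dotmulZr (second_order_contact _ _ _ rP 0 0) // mulrC.
have ME : sfM r = - bilin H (r_s r) (r_t r) / vnorm nF.
  by rewrite /sfM nE dotmulZr (second_order_contact _ _ _ rP 0 1) // mulrC.
have NE : sfN r = - bilin H (r_t r) (r_t r) / vnorm nF.
  by rewrite /sfN nE dotmulZr (second_order_contact _ _ _ rP 1 1) // mulrC.
have DE : ffE r * ffG r - ffF r ^+ 2 = vnorm w ^+ 2.
  by rewrite lagrange_identity sqr_vnorm.
rewrite /gauss_curvature /mean_curvature DE LE ME NE.
have G := gauss_identity _ (r_s r) (r_t r) Hs.
have M := mean_identity _ (r_s r) (r_t r) Hs.
rewrite -/(ffE r) -/(ffF r) -/(ffG r) -sqr_vnorm -/w in M.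
rewrite -/w in G.
(* The identities speak of [w], the goal of [nF]; the two are proportional. *)
have nnE A : bilin A nF nF = (vnorm nF / vnorm w) ^+ 2 * bilin A w w.
  by rewrite {1 2}nFE bilinZ.
have M' : bilin H w w = vnorm w ^+ 2 * \tr H - (ffE r * bilin H (r_t r) (r_t r)
    - 2%:R * ffF r * bilin H (r_s r) (r_t r) + ffG r * bilin H (r_s r) (r_s r)).
  by rewrite M subKr.
(* Eliminating [bilin H w w] makes the trace cancel in the mean curvature; both goals become
   rational identities with denominators in |nF| and |w|. *)
rewrite !nnE -G M'; move: a0 b0; clear.
move: (vnorm nF) (vnorm w) (\tr H) (ffE r) (ffF r) (ffG r).
move: (bilin H _ _) (bilin H _ _) (bilin H _ _) => x y z a b t e f g a0 b0.
by split; field; rewrite a0 b0.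
Qed.

Lemma at_origin_quad_surface (R : realType) (P u1 u2 u3 u4 u5 : 'rV[R]_3) :
  at_origin (quad_surface P u1 u2 u3 u4 u5) = P.
Proof.
apply/rowP => i; rewrite mxE tnth_mktuple.
by rewrite !(mevalD, mevalZ, mevalM, rmorphXn) /= mevalC !mevalXU; ring.
Qed.

Theorem theorem2 (R : realType) (F : {mpoly R[3]}) (P u1 u2 u3 u4 u5 : 'rV[R]_3)
    (r := quad_surface P u1 u2 u3 u4 u5) (nF := grad F P) (H := hessian F P) :
  regular_point F P ->
  crossmul u1 u2 != 0 ->
  contact_coef F r 1 0 = 0 ->
  contact_coef F r 0 1 = 0 ->
  contact_coef F r 2 0 = 0 ->
  contact_coef F r 1 1 = 0 ->
  contact_coef F r 0 2 = 0 ->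
  unit_normal r = (vnorm nF)^-1 *: nF ->
  gauss_curvature r = (nF *m \adj H *m nF^T) 0 0 / vnorm nF ^+ 4 /\
  mean_curvature r =
    ((nF *m H *m nF^T) 0 0 - vnorm nF ^+ 2 * \tr H) / (2%:R * vnorm nF ^+ 3).
Proof.
case=> _ nF0 _ _ _; apply: curvatures_of_contact => //.
exact: at_origin_quad_surface.
Qed.
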